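(* Let $S$ be a finite set of points in the plane $\mathbb{R}^2$ in general position. Then $S$ is in convex position if and only if every $4$-point subset of $S$ is in convex position.
   Context: A set of points in the plane is in general position if no three distinct points of it are collinear. A finite set $S \subset \mathbb{R}^2$ is in convex position if every point of $S$ is a vertex (extreme point) of the convex hull $\mathrm{conv}(S)$. *)

(* Defs.v *)
From mathcomp Require Import all_boot all_order all_algebra finmap.
From mathcomp Require Import all_classical all_reals.
From mathcomp Require Import interval_inference convex.

Set Implicit Arguments.
Unset Strict Implicit.
Unset Printing Implicit Defensive.

Import Order.TTheory GRing.Theory Num.Theory.
Local Open Scope classical_set_scope.
Local Open Scope ring_scope.
Local Open Scope convex_scope.

Definition line (R : realType) (E : lmodType R) (p v : E) : set E :=
  [set p + t *: v | t in [set: R]].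

Definition collinear (R : realType) (E : lmodType R) (A : set E) : Prop :=
  exists p v : E, v != 0 /\ A `<=` line p v.

Definition general_position (R : realType) (A : set 'rV[R]_2) : Prop :=
  forall x y z : 'rV[R]_2, A x -> A y -> A z ->
    x != y -> y != z -> x != z -> ~ collinear [set x; y; z].

Definition convex_hull (R : realType) (E : lmodType R)
    (A : set (convex_lmodType E)) : set (convex_lmodType E) :=
  smallest (@convex_set R E) A.

Definition extreme_point (R : realType) (E : lmodType R)
    (C : set (convex_lmodType E)) (x : convex_lmodType E) : Prop :=
  C x /\ forall (y z : convex_lmodType E) (t : {i01 R}), C y -> C z ->
    0 < t%:num < 1 -> x = y <| t |> z -> y = x /\ z = x.

Definition convex_position (R : realType) (S : {fset 'rV[R]_2}) : Prop :=
  forall x : 'rV[R]_2, x \in S -> extreme_point (convex_hull [set` S]) x.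

(* Main.v *)
Require Import Defs.
From mathcomp Require Import all_boot all_order all_algebra finmap.
From mathcomp Require Import all_classical all_reals.
From mathcomp Require Import interval_inference convex ring lra.

Set Implicit Arguments.
Unset Strict Implicit.
Unset Printing Implicit Defensive.

Import Order.TTheory GRing.Theory Num.Theory.

Local Open Scope classical_set_scope.
Local Open Scope ring_scope.

(** If [S] is in convex position, so are its subsets, because an extreme point
    of a set is extreme in every subset that contains it
    ([convex_position_sub]).

    Conversely, fix [x] in [S] and look at the other points from [x]. Order
    them by saying that [a] precedes [b] when [cross (a - x) (b - x) > 0], i.e.
    when one turns left from [a] to [b]. General position makes this relation a
    tournament. It has no cyclic triple: if [a], [b], [c] formed one, Cramer's
    rule would write [0] as a combination with positive coefficients of
    [a - x], [b - x], [c - x], so [x] would be in the interior of the triangle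
    [abc] and [{x, a, b, c}] would not be in convex position
    ([no_cyclic_triple]). A tournament without cyclic triples has a source
    ([acyclic_tournament_source]), here a point [m] such that all the other
    points are strictly to the left of the ray from [x] through [m]. The open
    left half-plane together with that ray is a convex set in which [x] is
    extreme; it contains [S], hence the hull of [S], so [x] is extreme in that
    hull too.

    Four points are used only to exclude cyclic triples, so the argument also
    covers sets with fewer points, where there are no such triples; when
    [S] is [{x}] there is no [m] and any direction gives a half-plane. *)

(** * Convex hulls and extreme points *)

Lemma convE (R : realType) (E : lmodType R) (t : {i01 R}) (x y : E) :
  conv t (x : convex_lmodType E) y = t%:num *: x + (1 - t%:num) *: y.
Proof. by []. Qed.

Lemma convex_set_convex_hull (R : realType) (E : lmodType R)
    (A : set (convex_lmodType E)) : convex_set (convex_hull A).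
Proof.
move=> x y t /set_mem hx /set_mem hy; apply/mem_set => B [cB AB].
by apply/set_mem/cB; apply/mem_set; [exact: hx|exact: hy].
Qed.

Lemma extreme_point_sub (R : realType) (E : lmodType R)
    (A B : set (convex_lmodType E)) (x : convex_lmodType E) :
  A `<=` B -> A x -> extreme_point B x -> extreme_point A x.
Proof.
move=> AB Ax [_ ext]; split=> // y z t Ay Az.
exact: ext (AB _ Ay) (AB _ Az).
Qed.

Lemma convex_position_sub (R : realType) (S T : {fset 'rV[R]_2}) :
  (T `<=` S)%fset -> convex_position S -> convex_position T.
Proof.
move=> /fsubsetP TS cS x xT.
apply: (@extreme_point_sub _ _ _ (convex_hull [set` S])); last exact/cS/TS.
  apply: smallest_sub; first exact: convex_set_convex_hull.
  by move=> y /TS yS; exact: sub_gen_smallest.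
exact: sub_gen_smallest.
Qed.

(** The barycentre [x] of [a], [b], [c] lies strictly between [a] and the
    barycentre of [b] and [c], so extremality forces these two to be [x]. *)
Lemma extreme_point_barycenter (R : realType) (E : lmodType R)
    (C : set (convex_lmodType E)) (x a b c : E) (p q r : R) :
  convex_set C -> extreme_point C x -> C a -> C b -> C c ->
  0 < p -> 0 < q -> 0 < r ->
  p *: (a - x) + q *: (b - x) + r *: (c - x) = 0 -> a = x.
Proof.
move=> cC [_ ext] Ca Cb Cc p0 q0 r0 e.
have s0 : 0 < p + (q + r) by lra.
have qr0 : 0 < q + r by lra.
have t0 : 0 <= q / (q + r) by apply: divr_ge0; lra.
have t1 : q / (q + r) <= 1 by rewrite ler_pdivrMr //; lra.
have u0 : 0 <= p / (p + (q + r)) by apply: divr_ge0; lra.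
have u1 : p / (p + (q + r)) <= 1 by rewrite ler_pdivrMr //; lra.
pose z : convex_lmodType E := conv (Itv01 t0 t1) (b : convex_lmodType E) c.
have Cz : C z by apply/set_mem/cC; apply/mem_set.
have [] // := ext a z (Itv01 u0 u1) Ca Cz.
  rewrite /= divr_gt0 //= ltr_pdivrMr //; lra.
have ex : (p + (q + r)) *: x = p *: a + (q *: b + r *: c).
  apply/esym/eqP; rewrite -subr_eq0 -[X in _ == X]e -[X in _ == X]addrA.
  by rewrite !scalerBr !scalerDl !opprD addrACA [X in _ + X == _]addrACA.
apply: (scalerI (lt0r_neq0 s0)); rewrite ex /z !convE /=.
rewrite !scalerDr !scalerA; congr (_ *: _ + (_ *: _ + _ *: _)); field.
all: by rewrite ?lt0r_neq0.
Qed.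

(** * The cross product in the plane *)

Definition cross (R : realType) (u v : 'rV[R]_2) : R :=
  u 0 0 * v 0 1 - u 0 1 * v 0 0.

Definition dot (R : realType) (u v : 'rV[R]_2) : R :=
  u 0 0 * v 0 0 + u 0 1 * v 0 1.

Lemma row2P (R : realType) (u v : 'rV[R]_2) :
  u 0 0 = v 0 0 -> u 0 1 = v 0 1 -> u = v.
Proof.
move=> e0 e1; apply/rowP => -[[|[|//]] i2].
  by rewrite (_ : Ordinal i2 = 0) //; exact: val_inj.
by rewrite (_ : Ordinal i2 = 1) //; exact: val_inj.
Qed.

Lemma crossC (R : realType) (u v : 'rV[R]_2) : cross u v = - cross v u.
Proof. rewrite /cross; ring. Qed.

Lemma crossvv (R : realType) (u : 'rV[R]_2) : cross u u = 0.
Proof. rewrite /cross; ring. Qed.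

(** Cramer's rule for three vectors of the plane. *)
Lemma cross_cramer (R : realType) (u v w : 'rV[R]_2) :
  cross v w *: u + cross w u *: v + cross u v *: w = 0.
Proof. by apply: row2P; rewrite !mxE /cross; ring. Qed.

Lemma dotvv_gt0 (R : realType) (v : 'rV[R]_2) : v != 0 -> 0 < dot v v.
Proof.
move=> v0; rewrite lt_neqAle addr_ge0 ?sqr_ge0 // andbT eq_sym.
apply: contraNneq v0 => /eqP.
rewrite paddr_eq0 ?sqr_ge0 // !mulf_eq0 !orbb => /andP[/eqP e0 /eqP e1].
by apply/eqP/row2P; rewrite mxE.
Qed.

(** In the orthogonal decomposition of [w] along [v] and the normal to [v], the
    coefficient of the normal is a multiple of [cross v w]. *)
Lemma cross_eq0_scale (R : realType) (v w : 'rV[R]_2) :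
  v != 0 -> cross v w = 0 -> w = (dot v w / dot v v) *: v.
Proof.
move=> /dotvv_gt0 /lt0r_neq0 d0 c0; apply: (scalerI d0).
rewrite scalerA mulrCA divff // mulr1.
apply: row2P; rewrite !mxE; apply/eqP; rewrite -subr_eq0.
  rewrite (_ : _ - _ = - v 0 1 * cross v w); first by rewrite c0 mulr0.
  rewrite /dot /cross; ring.
rewrite (_ : _ - _ = v 0 0 * cross v w); first by rewrite c0 mulr0.
rewrite /dot /cross; ring.
Qed.

Lemma general_position_cross (R : realType) (A : set 'rV[R]_2)
    (x a b : 'rV[R]_2) :
  general_position A -> A x -> A a -> A b -> a != x -> b != x -> a != b ->
  cross (a - x) (b - x) != 0.
Proof.
move=> gA Ax Aa Ab ax bx ab; apply/eqP => c0.
apply: (gA x a b) => //; rewrite 1?eq_sym //.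
exists x, (a - x); rewrite subr_eq0; split=> // y [[->|->]|->].
- by exists 0 => //; rewrite scale0r addr0.
- by exists 1 => //; rewrite scale1r addrC subrK.
- exists (dot (a - x) (b - x) / dot (a - x) (a - x)) => //.
  by rewrite -cross_eq0_scale ?subr_eq0 // addrC subrK.
Qed.

(** * Lexicographic half-planes *)

(** The open half-plane to the left of the line through [x] directed by [m],
    together with the ray from [x] in the direction [m]. The bounding ray is
    what makes [x] extreme: in the closed half-plane [x] would be interior to a
    segment of the boundary line. *)
Definition lex_halfplane (R : realType) (m x : 'rV[R]_2) :
    set (convex_lmodType 'rV[R]_2) :=
  [set p : 'rV[R]_2 | 0 < cross m (p - x) \/
    cross m (p - x) = 0 /\ 0 <= dot m (p - x)].

Lemma cross_conv (R : realType) (m x y z : 'rV[R]_2) (t : {i01 R}) :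
  cross m (conv t (y : convex_lmodType 'rV[R]_2) z - x) =
  t%:num * cross m (y - x) + (1 - t%:num) * cross m (z - x).
Proof. rewrite convE /cross !mxE; ring. Qed.

Lemma dot_conv (R : realType) (m x y z : 'rV[R]_2) (t : {i01 R}) :
  dot m (conv t (y : convex_lmodType 'rV[R]_2) z - x) =
  t%:num * dot m (y - x) + (1 - t%:num) * dot m (z - x).
Proof. rewrite convE /dot !mxE; ring. Qed.

Lemma convex_set_lex_halfplane (R : realType) (m x : 'rV[R]_2) :
  convex_set (lex_halfplane m x).
Proof.
apply/convex_setW => y z /set_mem hy /set_mem hz t t0 t1.
apply/mem_set; rewrite /lex_halfplane /= cross_conv dot_conv.
have u0 : 0 < 1 - t%:num by lra.
case: hy => [cy|[cy dy]]; case: hz => [cz|[cz dz]]; rewrite ?cy ?cz.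
1-3: by left; nra.
by right; split; nra.
Qed.

(** If [x] is strictly between [y] and [z], the nonnegative numbers
    [cross m (y - x)] and [cross m (z - x)] have a vanishing weighted sum, so
    both are zero; the same then holds of the dot products, and a vector whose
    cross and dot products with [m] vanish is zero. *)
Lemma extreme_point_lex_halfplane (R : realType) (m x : 'rV[R]_2) :
  m != 0 -> extreme_point (lex_halfplane m x) x.
Proof.
move=> m0.
have cxx : cross m (x - x) = 0 by rewrite /cross !mxE; ring.
have dxx : dot m (x - x) = 0 by rewrite /dot !mxE; ring.
split=> [|y z t hy hz /andP[t0 t1] e]; first by right; rewrite cxx dxx.
have c : t%:num * cross m (y - x) + (1 - t%:num) * cross m (z - x) = 0.
  by rewrite -cross_conv -e.
have d : t%:num * dot m (y - x) + (1 - t%:num) * dot m (z - x) = 0.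
  by rewrite -dot_conv -e.
have u0 : 0 < 1 - t%:num by lra.
have eq_x (w : 'rV[R]_2) : cross m (w - x) = 0 -> dot m (w - x) = 0 -> w = x.
  move=> cw dw; apply/eqP; rewrite -subr_eq0 (cross_eq0_scale m0 cw).
  by rewrite dw mul0r scale0r.
case: hy => [cy|[cy dy]]; case: hz => [cz|[cz dz]].
1-3: by exfalso; move: c; rewrite ?cy ?cz; nra.
by split; apply: eq_x => //; nra.
Qed.

(** * Tournaments *)

(** A tournament without cyclic triples is transitive. By induction on [s]: if
    the new vertex [a] beats the source [m] of the rest, it beats whatever [m]
    beats. *)
Lemma acyclic_tournament_source (T : eqType) (r : rel T) (s : seq T) :
  {in s &, forall a b, a != b -> r a b || r b a} ->
  {in s & &, forall a b c, r a b -> r b c -> ~~ r c a} ->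
  s != [::] -> exists2 m, m \in s & {in s, forall a, a != m -> r m a}.
Proof.
elim: s => // a s IH tot acy _.
have [->|s0] := eqVneq s [::].
  by exists a; rewrite ?mem_head // => b; rewrite inE => ->.
have sub b : b \in s -> b \in a :: s by rewrite inE orbC => ->.
have [|||m ms minm] := IH.
- by move=> b c /sub bs /sub cs; exact: tot.
- by move=> b c d /sub bs /sub cs /sub ds; exact: acy.
- exact: s0.
have as_ : a \in a :: s by rewrite mem_head.
have [ma|ma] := boolP ((a == m) || r m a).
  exists m; first exact: sub.
  move=> b; rewrite inE => /predU1P[->|]; last exact: minm.
  by case/orP: ma => [->|].
move: ma; rewrite negb_or => /andP[am nma].
have ram : r a m by have := tot _ _ as_ (sub _ ms) am; rewrite (negPf nma) orbF.
exists a => // b; rewrite inE => /predU1P[->|bs ba]; first by rewrite eqxx.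
have [->//|bm] := eqVneq b m.
have := tot _ _ as_ (sub _ bs); rewrite eq_sym => /(_ ba) /orP[//|rba].
by have := acy _ _ _ as_ (sub _ ms) (sub _ bs) ram (minm _ bs bm); rewrite rba.
Qed.

(** * Points seen from a point of the set *)

Lemma no_cyclic_triple (R : realType) (S : {fset 'rV[R]_2})
    (x a b c : 'rV[R]_2) :
  (forall T : {fset 'rV[R]_2}, (T `<=` S)%fset -> #|` T| = 4%N ->
    convex_position T) ->
  x \in S -> a \in S -> b \in S -> c \in S ->
  0 < cross (a - x) (b - x) -> 0 < cross (b - x) (c - x) ->
  ~~ (0 < cross (c - x) (a - x)).
Proof.
move=> h4 xS aS bS cS ab bc; apply/negP => ca.
have cross0 (u : 'rV[R]_2) : cross 0 u = 0 by rewrite /cross !mxE; ring.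
have neq_cross u v : 0 < cross (u - x) (v - x) -> (u != v) && (u != x).
  move=> uv; apply/andP; split; apply: contraTneq uv => ->.
    by rewrite crossvv ltxx.
  by rewrite subrr cross0 ltxx.
have [/andP[anb anx] /andP[bnc bnx]] := (neq_cross _ _ ab, neq_cross _ _ bc).
have /andP[cna cnx] := neq_cross _ _ ca.
pose s := [:: x; a; b; c].
pose T := [fset y in s]%fset.
have TS : (T `<=` S)%fset.
  by apply/fsubsetP => y; rewrite !inE orbF => /or4P[] /eqP ->.
have T4 : #|` T| = 4%N.
  rewrite card_fseq undup_id //= !inE !negb_or ![x == _]eq_sym.
  by rewrite anx bnx cnx anb bnc [a == c]eq_sym cna.
have hull y : y \in s -> convex_hull [set` T] y.
  by move=> ys; apply: sub_gen_smallest; rewrite /= !inE.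
have xT : x \in T by rewrite !inE eqxx.
move/eqP: anx; apply.
(* Cramer's rule makes x a barycentre of the other three points. *)
apply: (extreme_point_barycenter _ (h4 T TS T4 x xT) _ _ _ bc ca ab
  (cross_cramer (a - x) (b - x) (c - x))).
- exact: convex_set_convex_hull.
- by apply: hull; rewrite !inE eqxx !orbT.
- by apply: hull; rewrite !inE eqxx !orbT.
- by apply: hull; rewrite !inE eqxx !orbT.
Qed.

Lemma exists_lex_halfplane (R : realType) (S : {fset 'rV[R]_2})
    (x : 'rV[R]_2) :
  general_position [set` S] ->
  (forall T : {fset 'rV[R]_2}, (T `<=` S)%fset -> #|` T| = 4%N ->
    convex_position T) ->
  x \in S ->
  exists2 m : 'rV[R]_2, m != 0 & [set` S] `<=` lex_halfplane m x.
Proof.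
move=> gS h4 xS.
have xx m : lex_halfplane m x x.
  by right; rewrite /cross /dot !mxE; split; [ring|rewrite !subrr !mulr0 addr0].
pose s := [seq y <- S | y != x].
have memE y : (y \in s) = (y != x) && (y \in S) by rewrite mem_filter.
have [s0|s0] := eqVneq s [::].
  (* There is no point besides x to give a direction: any one will do. *)
  exists (const_mx 1).
    by apply/eqP => /rowP /(_ 0) /eqP; rewrite !mxE oner_eq0.
  move=> y /= yS; have [->//|yx] := eqVneq y x.
  by have := memE y; rewrite yx yS s0.
pose r (a b : 'rV[R]_2) := 0 < cross (a - x) (b - x).
have [||m] := @acyclic_tournament_source _ r s _ _ s0.
- move=> a b; rewrite !memE => /andP[ax aS] /andP[bx bS] ab.
  rewrite /r (crossC (b - x)) oppr_gt0 orbC -neq_lt.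
  exact: (@general_position_cross _ [set` S]).
- move=> a b c; rewrite !memE => /andP[_ aS] /andP[_ bS] /andP[_ cS].
  exact: (@no_cyclic_triple _ S).
rewrite memE => /andP[mx mS] minm.
exists (m - x); rewrite ?subr_eq0 // => y /= yS.
have [->//|yx] := eqVneq y x.
have [->|ym] := eqVneq y m; last by left; apply: minm; rewrite // memE yx.
by right; rewrite crossvv ltW // dotvv_gt0 // subr_eq0.
Qed.

Theorem proposition1 (R : realType) (S : {fset 'rV[R]_2})
    (hS : general_position [set` S]) :
  convex_position S <->
  forall T : {fset 'rV[R]_2}, (T `<=` S)%fset -> #|` T| = 4%N ->
    convex_position T.
Proof.
split=> [cS T TS _|h4 x xS]; first exact: convex_position_sub cS.
have [m m0 Sm] := exists_lex_halfplane hS h4 xS.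
apply: extreme_point_sub (extreme_point_lex_halfplane x m0).
  by apply: smallest_sub => //; exact: convex_set_lex_halfplane.
exact: sub_gen_smallest.
Qed.
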